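(* Let $m$ be a positive integer, $\lambda\in\mathbb{R}$, and $n\ge 0$. Then for all $0\le k\le n$, $$V_{m,\lambda}^{(0)}(n,k)=m^{n-k}S_{1,\frac{\lambda}{m}}(n,k),\qquad W_{m,\lambda}^{(0)}(n,k)=m^{n-k}S_{2,\frac{\lambda}{m}}(n,k).$$
   Context: For $\lambda\in\mathbb{R}$, the generalized falling factorial is $(x)_{0,\lambda}=1$, $(x)_{n,\lambda}=x(x-\lambda)(x-2\lambda)\cdots(x-(n-1)\lambda)$ for $n\ge1$; $(x)_n=(x)_{n,1}$ is the ordinary falling factorial. The degenerate Stirling numbers of the first kind $S_{1,\lambda}(n,k)$ and of the second kind $S_{2,\lambda}(n,k)$ are defined by $(x)_n=\sum_{k=0}^n S_{1,\lambda}(n,k)(x)_{k,\lambda}$ and $(x)_{n,\lambda}=\sum_{k=0}^n S_{2,\lambda}(n,k)(x)_k$ (identities of polynomials in $x$). For a positive integer $m$ and a nonnegative integer $r$, the degenerate $r$-Whitney numbers of the second kind $W_{m,\lambda}^{(r)}(n,k)$ and of the first kind $V_{m,\lambda}^{(r)}(n,k)$ are defined by the polynomial identities $(mx+r)_{n,\lambda}=\sum_{k=0}^n W_{m,\lambda}^{(r)}(n,k)m^k(x)_k$ and $m^n(x)_n=\sum_{k=0}^n V_{m,\lambda}^{(r)}(n,k)(mx+r)_{k,\lambda}$, $n\ge0$. *)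

(* Defs.v *)
From HB Require Import structures.
From mathcomp Require Import all_boot all_order all_algebra.
From mathcomp Require Import boolp classical_sets reals.

Set Implicit Arguments.
Unset Strict Implicit.
Unset Printing Implicit Defensive.

Import Order.TTheory GRing.Theory Num.Theory.
Local Open Scope classical_set_scope.
Local Open Scope ring_scope.

Section DegenerateNumbers.
Variable R : realType.
Implicit Types (p q : {poly R}) (lambda : R) (b : nat -> {poly R}).

Definition gfalling p lambda n : {poly R} :=
  \prod_(i < n) (p - (i%:R * lambda)%:P).

Definition falling p n : {poly R} := gfalling p 1 n.

(* The sequence c with q = c 0 *: b 0 + ... + c n *: b n, extended by 0 beyond
   n.  It exists and is unique as soon as every b k has degree exactly k and q
   has degree at most n (lemmas expansionP and expansion_uniq below); the
   default value 0 of xget is never used in that case. *)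
Definition expansion b n q : nat -> R :=
  xget (fun=> 0) [set c : nat -> R |
    q = \sum_(k < n.+1) c k *: b k /\ forall k, (n < k)%N -> c k = 0].

Definition stirling1 lambda (n k : nat) : R :=
  expansion (gfalling 'X lambda) n (falling 'X n) k.

Definition stirling2 lambda (n k : nat) : R :=
  expansion (falling 'X) n (gfalling 'X lambda n) k.

Definition mXr (m r : nat) : {poly R} := m%:R *: 'X + r%:R%:P.

Definition whitney2 (m r : nat) lambda (n k : nat) : R :=
  expansion (fun k => m%:R ^+ k *: falling 'X k) n
    (gfalling (mXr m r) lambda n) k.

Definition whitney1 (m r : nat) lambda (n k : nat) : R :=
  expansion (gfalling (mXr m r) lambda) n (m%:R ^+ n *: falling 'X n) k.

Lemma expansion_ex b n q : (forall k, size (b k) = k.+1) ->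
  (size q <= n.+1)%N ->
  exists c : nat -> R,
    q = \sum_(k < n.+1) c k *: b k /\ forall k, (n < k)%N -> c k = 0.
Proof.
move=> sb; suff H N : forall q, (size q <= N)%N ->
  exists c : nat -> R,
    q = \sum_(k < N) c k *: b k /\ forall k, (N <= k)%N -> c k = 0.
  exact: H.
elim: N => [|N IH] {}q sq.
  exists (fun=> 0); split=> //; rewrite big_ord0.
  by apply/eqP; rewrite -size_poly_leq0.
have lb : (b N)`_N != 0.
  by have := lead_coef_eq0 (b N); rewrite lead_coefE sb /= => ->;
     rewrite -size_poly_eq0 sb.
pose a := q`_N / (b N)`_N.
have [|c [qE c0]] := IH (q - a *: b N).
  apply/leq_sizeP => j; rewrite leq_eqVlt coefB coefZ => /predU1P[<-|Nj].
    by rewrite divfK ?subrr.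
  by rewrite (leq_sizeP _ _ sq) // nth_default ?sb // mulr0 subr0.
exists (fun k => if k == N then a else c k); split=> [|k Nk].
  rewrite big_ord_recr /= eqxx; apply/eqP; rewrite -subr_eq qE; apply/eqP.
  by apply: eq_bigr => i _; rewrite ltn_eqF.
by rewrite gtn_eqF // c0 // ltnW.
Qed.

Lemma expansionP b n q : (forall k, size (b k) = k.+1) ->
  (size q <= n.+1)%N -> q = \sum_(k < n.+1) expansion b n q k *: b k.
Proof.
by move=> sb sq; rewrite /expansion; case: xgetP => [c _ []//|H];
  have [c /H] := expansion_ex sb sq.
Qed.

Lemma expansion_uniq b n q (c : nat -> R) : (forall k, size (b k) = k.+1) ->
  q = \sum_(k < n.+1) c k *: b k ->
  forall k, (k <= n)%N -> expansion b n q k = c k.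
Proof.
move=> sb qE k.
have sq : (size q <= n.+1)%N.
  rewrite qE; apply: (leq_trans (size_sum _ _ _)); apply/bigmax_leqP => i _.
  by rewrite (leq_trans (size_scale_leq _ _)) ?sb.
have := expansionP sb sq; rewrite {1}qE => /esym/eqP.
rewrite -subr_eq0 -sumrB.
under eq_bigr do rewrite -scalerBl.
rewrite -[(k <= n)%N]ltnS; set d := expansion b n q.
elim: n.+1 => // N IH; rewrite big_ord_recr /= => /eqP E.
have dN : d N - c N = 0.
  have := congr1 (fun p : {poly R} => p`_N) E.
  rewrite coefD coefZ coef0 nth_default ?add0r.
    by move/eqP; rewrite mulf_eq0 => /orP[/eqP//|];
      have := lead_coef_eq0 (b N); rewrite lead_coefE sb /= => ->;
      rewrite -size_poly_eq0 sb.
  apply: (leq_trans (size_sum _ _ _)); apply/bigmax_leqP => i _.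
  by rewrite (leq_trans (size_scale_leq _ _)) ?sb.
rewrite ltnS leq_eqVlt => /predU1P[->|]; first by apply/eqP; rewrite -subr_eq0 dN.
by move: E; rewrite dN scale0r addr0 => /eqP; apply: IH.
Qed.

Lemma size_gfalling p lambda n : size p = 2 -> size (gfalling p lambda n) = n.+1.
Proof.
move=> sp; have s2 a : size (p - a%:P) = 2.
  by rewrite size_polyDl ?sp // size_polyN ltnS size_polyC_leq1.
elim: n => [|n IH]; first by rewrite /gfalling big_ord0 size_poly1.
rewrite /gfalling big_ord_recr /= -/(gfalling p lambda n).
by rewrite size_mul -?size_poly_eq0 ?IH ?s2 // addn2.
Qed.

Lemma size_mXr m r : (0 < m)%N -> size (mXr m r) = 2.
Proof.
move=> m0; have sX : size (m%:R *: 'X : {poly R}) = 2.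
  by rewrite size_scale ?size_polyX // pnatr_eq0 -lt0n.
by rewrite size_polyDl ?sX // ltnS size_polyC_leq1.
Qed.

Lemma stirling1P lambda n :
  falling 'X n = \sum_(k < n.+1) stirling1 lambda n k *: gfalling 'X lambda k.
Proof.
by apply: expansionP => [k|]; rewrite size_gfalling ?size_polyX.
Qed.

Lemma stirling2P lambda n :
  gfalling 'X lambda n = \sum_(k < n.+1) stirling2 lambda n k *: falling 'X k.
Proof.
by apply: expansionP => [k|]; rewrite size_gfalling ?size_polyX.
Qed.

Lemma whitney2P m r lambda n : (0 < m)%N ->
  gfalling (m%:R *: 'X + r%:R%:P) lambda n =
  \sum_(k < n.+1) (whitney2 m r lambda n k * m%:R ^+ k) *: falling 'X k.
Proof.
move=> m0; under eq_bigr do rewrite -scalerA.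
apply: expansionP => [k|]; last by rewrite size_gfalling ?size_mXr.
by rewrite size_scale ?size_gfalling ?size_polyX // expf_neq0 // pnatr_eq0 -lt0n.
Qed.

Lemma whitney1P m r lambda n : (0 < m)%N ->
  m%:R ^+ n *: falling 'X n =
  \sum_(k < n.+1)
    whitney1 m r lambda n k *: gfalling (m%:R *: 'X + r%:R%:P) lambda k.
Proof.
move=> m0; apply: expansionP => [k|]; first by rewrite size_gfalling ?size_mXr.
by rewrite (leq_trans (size_scale_leq _ _)) // size_gfalling ?size_polyX.
Qed.

End DegenerateNumbers.

(* Main.v *)
Require Import Defs.
From HB Require Import structures.
From mathcomp Require Import all_boot all_order all_algebra.
From mathcomp Require Import boolp classical_sets reals.

Set Implicit Arguments.
Unset Strict Implicit.
Unset Printing Implicit Defensive.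

Import Order.TTheory GRing.Theory Num.Theory.
Local Open Scope ring_scope.

(** For [r = 0] everything reduces to the scaling rule $(mx)_{k,\lambda} = m^k (x)_{k,\lambda/m}$
    ([gfallingZ]). Multiplying the Stirling expansions with parameter $\lambda/m$ by $m^n = m^{n-k}
    m^k$ and absorbing $m^k$ into the basis gives Whitney expansions; since the basis has one
    polynomial in each degree, coefficients are unique ([expansion_uniq]). *)

Lemma gfallingZ (R : realType) (a : R) (p : {poly R}) (lambda : R) (n : nat) :
  a != 0 -> gfalling (a *: p) lambda n = a ^+ n *: gfalling p (lambda / a) n.
Proof.
move=> a0; rewrite /gfalling; elim: n => [|n IH].
  by rewrite !big_ord0 scale1r.
rewrite !big_ord_recr /= IH exprSr -scalerA -scalerAl; congr (_ *: _).
rewrite scalerAr; congr (_ * _).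
(* The roots match: [a * (n%:R * (lambda / a)) = n%:R * lambda], as [a != 0]. *)
by rewrite scalerBr -!mul_polyC -polyCM mulrCA [a * _]mulrC divfK.
Qed.

Lemma mXr0 (R : realType) (m : nat) : mXr R m 0 = m%:R *: 'X.
Proof. by rewrite /mXr polyC0 addr0. Qed.

Theorem theorem1 (R : realType) (m : nat) (lambda : R) (n : nat) :
  (0 < m)%N ->
  forall k : nat, (k <= n)%N ->
    whitney1 m 0 lambda n k = m%:R ^+ (n - k) * stirling1 (lambda / m%:R) n k /\
    whitney2 m 0 lambda n k = m%:R ^+ (n - k) * stirling2 (lambda / m%:R) n k.
Proof.
move=> m0 k kn; have mR0 : m%:R != 0 :> R by rewrite pnatr_eq0 -lt0n.
split.
- apply: (expansion_uniq (c := fun j =>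
    m%:R ^+ (n - j) * stirling1 (lambda / m%:R) n j)) kn => [j|].
    by rewrite size_gfalling ?size_mXr.
  rewrite {1}(stirling1P (lambda / m%:R)) scaler_sumr.
  (* The bound [j <= n] is kept because [n - j] is truncated: [m ^ (n - j) * m ^ j = m ^ n] needs
     it. *)
  apply: eq_bigr => -[j] /=; rewrite ltnS => jn _.
  rewrite mXr0 gfallingZ // !scalerA; congr (_ *: _).
  by rewrite mulrAC -exprD subnK.
- apply: (expansion_uniq (c := fun j =>
    m%:R ^+ (n - j) * stirling2 (lambda / m%:R) n j)) kn => [j|].
    by rewrite size_scale ?expf_neq0 // size_gfalling ?size_polyX.
  (* Here scaling acts on the expanded polynomial, giving [m ^ n]; the basis already carries
     [m ^ j]. *)
  rewrite mXr0 gfallingZ // stirling2P scaler_sumr.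
  apply: eq_bigr => -[j] /=; rewrite ltnS => jn _.
  by rewrite !scalerA mulrAC -exprD subnK.
Qed.
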